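(* Let $(W,S)$ and $(W',S')$ be Coxeter systems (with $S$, $S'$ finite) with Coxeter matrices $M=(m_{s,r})_{s,r\in S}$ and $M'=(m'_{s,r})_{s,r\in S'}$ respectively. For $k\in\mathbb{N}_0$ let $a_k=a_k^{(W,S)}$ be the number of elements of $W$ of length exactly $k$ with respect to $S$, and let $a'_k=a_k^{(W',S')}$ be the number of elements of $W'$ of length exactly $k$ with respect to $S'$. If $(W,S)\preceq(W',S')$, i.e. if there exists an injective map $\varphi\colon S\to S'$ such that $m_{s,r}\le m'_{\varphi(s),\varphi(r)}$ for all $s,r\in S$, then $a_k\le a'_k$ for all $k\in\mathbb{N}_0$.
   Context: A Coxeter matrix over a finite set $S$ is a symmetric $(S\times S)$-matrix $M=(m_{s,r})$ with $m_{s,s}=1$ and $m_{s,r}=m_{r,s}\in\mathbb{Z}_{\ge 2}\cup\{\infty\}$ for $s\ne r$. The associated Coxeter system is the pair $(W,S)$ with $W=\langle S\mid (sr)^{m_{s,r}}\text{ if }m_{s,r}<\infty\rangle$. The length $\ell_{(W,S)}(w)$ of $w\in W$ is the least $n$ such that $w$ is a product of $n$ elements of $S$. Labels are compared in $\mathbb{Z}_{\geq 1}\cup\{\infty\}$, where every integer is less than $\infty$. *)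

(* Defs.v *)
From HB Require Import structures.
From mathcomp Require Import all_boot finmap all_classical.

Set Implicit Arguments.
Unset Strict Implicit.
Unset Printing Implicit Defensive.

Local Open Scope classical_set_scope.
Local Open Scope group_scope.

(* The letter (x, true) stands for the generator x, (x, false) for its formal
   inverse, so that a word represents an element of the free group on X. *)
Notation word X := (seq (X * bool)).

Definition word_inv (X : Type) (u : word X) : word X :=
  rev [seq (a.1, ~~ a.2) | a <- u].

(* Two words are related iff they represent the same element of the quotient of
   the free group on X by the normal closure of R. *)
Inductive pres_eq (X : Type) (R : set (word X)) : word X -> word X -> Prop :=
| PresRefl u : pres_eq R u u
| PresSym u v : pres_eq R u v -> pres_eq R v u
| PresTrans u v w : pres_eq R u v -> pres_eq R v w -> pres_eq R u w
| PresCancel u v x b : pres_eq R (u ++ [:: (x, b); (x, ~~ b)] ++ v) (u ++ v)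
| PresRelator u v r : R r -> pres_eq R (u ++ r ++ v) (u ++ v).

Section Presentation.
Variables (X : choiceType) (R : set (word X)).
Implicit Types u v w : word X.

Let pres_eqb : rel (word X) := fun u v => `[< pres_eq R u v >].

Fact pres_eqb_refl : reflexive pres_eqb.
Proof. by move=> u; apply/asboolP/PresRefl. Qed.

Fact pres_eqb_sym : symmetric pres_eqb.
Proof. by move=> u v; apply: asbool_equiv_eq; split; apply: PresSym. Qed.

Fact pres_eqb_trans : transitive pres_eqb.
Proof.
by move=> v u w /asboolP uv /asboolP vw; apply/asboolP/(PresTrans uv vw).
Qed.

Canonical pres_equiv := EquivRel pres_eqb pres_eqb_refl pres_eqb_sym pres_eqb_trans.

Definition presented_group := {eq_quot pres_equiv}%qT.

HB.instance Definition _ := Choice.on presented_group.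

Definition pres_class u : presented_group := (\pi_({eq_quot pres_equiv}) u)%qT.

Lemma pres_classP u v : pres_class u = pres_class v <-> pres_eq R u v.
Proof.
split=> [/(@eqmodP _ pres_equiv)|uv]; first by move/asboolP.
by apply/(@eqmodP _ pres_equiv)/asboolP.
Qed.

Definition pres_repr (x : presented_group) : word X :=
  repr (x : {eq_quot pres_equiv}%qT).

Lemma pres_reprK x : pres_class (pres_repr x) = x.
Proof. exact: (@reprK _ {eq_quot pres_equiv}%qT). Qed.

Lemma pres_eq_cat u u' v v' :
  pres_eq R u u' -> pres_eq R v v' -> pres_eq R (u ++ v) (u' ++ v').
Proof.
move=> uu' vv'; apply: (@PresTrans _ _ _ (u' ++ v)).
  elim: uu' v {vv'} => {u u'} [u|u w _ IH|u w t _ IH1 _ IH2|u w x b|u w r Rr] v.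
  - exact: PresRefl.
  - exact: PresSym.
  - exact: PresTrans (IH2 _).
  - by rewrite -!catA; apply: PresCancel.
  - by rewrite -!catA; apply: PresRelator.
elim: vv' u' {uu'} => {u v v'} [u|u w _ IH|u w t _ IH1 _ IH2|u w x b|u w r Rr] v.
- exact: PresRefl.
- exact: PresSym.
- exact: PresTrans (IH2 _).
- by rewrite (catA v u) (catA v u w); apply: PresCancel.
- by rewrite (catA v u) (catA v u w); apply: PresRelator.
Qed.

Lemma word_inv_cat u v : word_inv (u ++ v) = word_inv v ++ word_inv u.
Proof. by rewrite /word_inv map_cat rev_cat. Qed.

Lemma word_invK : involutive (@word_inv X).
Proof.
move=> u; rewrite /word_inv map_rev revK -map_comp.
by rewrite -[RHS]map_id; apply: eq_map => -[x b] /=; rewrite negbK.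
Qed.

Lemma pres_eq_mulV u : pres_eq R (u ++ word_inv u) [::].
Proof.
elim: u => [|[x b] u IH]; first exact: PresRefl.
rewrite -cat1s word_inv_cat -catA (catA u).
apply: PresTrans (PresCancel R [::] [::] x b).
exact: (pres_eq_cat (PresRefl R [:: (x, b)])
                    (pres_eq_cat IH (PresRefl R [:: (x, ~~ b)]))).
Qed.

Lemma pres_eq_Vmul u : pres_eq R (word_inv u ++ u) [::].
Proof. by rewrite -[X in _ ++ X]word_invK; apply: pres_eq_mulV. Qed.

Let mul (x y : presented_group) := pres_class (pres_repr x ++ pres_repr y).
Let inv (x : presented_group) := pres_class (word_inv (pres_repr x)).
Let one := pres_class [::].

Fact pres_repr_class u : pres_eq R (pres_repr (pres_class u)) u.
Proof. by apply/pres_classP; rewrite pres_reprK. Qed.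

Fact pres_mulE u v : mul (pres_class u) (pres_class v) = pres_class (u ++ v).
Proof. by apply/pres_classP/pres_eq_cat; apply: pres_repr_class. Qed.

Fact pres_mulA : associative mul.
Proof.
move=> x y z; rewrite -(pres_reprK x) -(pres_reprK y) -(pres_reprK z).
by rewrite !pres_mulE catA.
Qed.

Fact pres_mul1 : left_id one mul.
Proof. by move=> x; rewrite -(pres_reprK x) pres_mulE. Qed.

Fact pres_mulr1 : right_id one mul.
Proof. by move=> x; rewrite -(pres_reprK x) pres_mulE cats0. Qed.

Fact pres_mulV : left_inverse one inv mul.
Proof.
move=> x; rewrite -[x in mul _ x]pres_reprK pres_mulE.
by apply/pres_classP/pres_eq_Vmul.
Qed.

Fact pres_mulrV : right_inverse one inv mul.
Proof.
move=> x; rewrite -[x in mul x _]pres_reprK pres_mulE.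
by apply/pres_classP/pres_eq_mulV.
Qed.

HB.instance Definition _ := isGroup.Build presented_group
  pres_mulA pres_mul1 pres_mulr1 pres_mulV pres_mulrV.

Definition pres_gen (x : X) : presented_group := pres_class [:: (x, true)].

Lemma pres_class_cat u v : pres_class (u ++ v) = pres_class u * pres_class v.
Proof. by rewrite -pres_mulE. Qed.

Lemma pres_class_nil : pres_class [::] = 1.
Proof. by []. Qed.

Lemma pres_class_relator r : R r -> pres_class r = 1.
Proof.
by move=> Rr; apply/pres_classP; have := PresRelator [::] [::] Rr; rewrite cats0.
Qed.

Lemma pres_class_letter x b :
  pres_class [:: (x, b)] = if b then pres_gen x else (pres_gen x)^-1.
Proof.
case: b => //; apply/esym/(mulgI (pres_gen x)); rewrite mulgV -pres_class_cat.
by apply/esym/pres_classP; apply: (PresCancel R [::] [::] x true).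
Qed.

End Presentation.

(* Labels live in option nat, None being the label infinity. *)
Record coxeter_matrix (S : finType) := CoxeterMatrix {
  label :> S -> S -> option nat;
  label_diag : forall s, label s s = Some 1%N;
  label_sym : forall s r, label s r = label r s;
  label_offdiag : forall s r m, s != r -> label s r = Some m -> (2 <= m)%N }.

Definition label_le (a b : option nat) : bool :=
  match a, b with
  | _, None => true
  | None, Some _ => false
  | Some m, Some n => (m <= n)%N
  end.

Definition coxeter_le (S S' : finType)
    (M : coxeter_matrix S) (M' : coxeter_matrix S') : Prop :=
  exists phi : S -> S',
    injective phi /\ forall s r, label_le (M s r) (M' (phi s) (phi r)).

Definition coxeter_relators (S : finType) (M : coxeter_matrix S) :
    set (word S) :=
  [set w | exists s r m,
     M s r = Some m /\ w = flatten (nseq m [:: (s, true); (r, true)])].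

Section CoxeterSystem.
Variables (S : finType) (M : coxeter_matrix S).

Definition coxeter_group := presented_group (coxeter_relators M).

HB.instance Definition _ := Group.on coxeter_group.

Definition coxeter_gen (s : S) : coxeter_group :=
  pres_gen (coxeter_relators M) s.

Lemma coxeter_genV s : (coxeter_gen s)^-1 = coxeter_gen s.
Proof.
apply/(mulgI (coxeter_gen s)); rewrite mulgV; apply/esym.
rewrite /coxeter_gen /pres_gen -pres_class_cat; apply: pres_class_relator.
by exists s, s, 1%N; rewrite label_diag.
Qed.

Definition is_product_of (w : coxeter_group) (n : nat) : Prop :=
  exists u : n.-tuple S, w = \prod_(s <- u) coxeter_gen s.

Fact coxeter_length_subproof (w : coxeter_group) :
  exists n, `[< is_product_of w n >].
Proof.
suff [u ->] : exists u : seq S, w = \prod_(s <- u) coxeter_gen s.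
  by exists (size u); apply/asboolP; exists (in_tuple u).
rewrite -[w]pres_reprK; elim: (pres_repr w) => [|[s b] u [v IH]].
  by exists [::]; rewrite big_nil.
exists (s :: v); rewrite big_cons -IH -cat1s pres_class_cat pres_class_letter.
by case: b => //; rewrite -/(coxeter_gen s) coxeter_genV.
Qed.

Definition coxeter_length (w : coxeter_group) : nat :=
  ex_minn (coxeter_length_subproof w).

Definition coxeter_sphere (k : nat) : set coxeter_group :=
  [set w | coxeter_length w = k].

Lemma finite_coxeter_sphere k : finite_set (coxeter_sphere k).
Proof.
apply: (@sub_finite_set _ _
  ((fun u : k.-tuple S => \prod_(s <- u) coxeter_gen s) @` setT)).
  move=> w; rewrite /coxeter_sphere /= /coxeter_length.
  by case: ex_minnP => n /asboolP[u ->] _ <-; exists u.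
exact/finite_image/finite_finset.
Qed.

(* fset_set is meaningful here because the spheres are finite
   (finite_coxeter_sphere). *)
Definition coxeter_growth (k : nat) : nat := #|` fset_set (coxeter_sphere k)|.

End CoxeterSystem.

(* Main.v *)
Require Import Defs.
From mathcomp Require Import all_boot.
From mathcomp Require Import all_algebra all_field finmap all_classical ring.

(** A reduced word of the smaller system stays reduced when its letters are
    mapped to the larger one, and two words so obtained represent the same
    element only if the original words did.  Choosing a reduced word for every
    element therefore embeds the spheres of the first group into those of the
    second.

    Both facts follow from Matsumoto's theorem for the larger system: reduced
    words of the same element are joined by braid moves, which replace
    [s r s ...] by [r s r ...], both with [m] letters, where [m] is the label of
    [s] and [r] ([reduced_braid_eq]).  A braid move on the image of a reduced
    word lifts to the smaller system ([braid_eq_map]): its two letters come from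
    letters of the smaller system, and if their label there were smaller, the
    original word would contain an alternating subword longer than this label,
    which is never reduced.  So words joined by braid moves in the larger system
    come from words for one element of the smaller one ([word_prod_map_inj]),
    and a word that stops being reduced under the map would, by exchange and
    Matsumoto's theorem, have been non-reduced before ([reduced_map]).

    Matsumoto's theorem rests on two properties of a Coxeter group given by its
    presentation.  Each is read off an action, defined on the generators and
    checked on the relators ([foldl_word_prod]).
    - The exchange condition ([exchange]) comes from the action on
      (element, sign) pairs in which [s] conjugates the element and changes the
      sign when the element is [s]; it shows that the parity of the number of
      times that a given element occurs among the reflections of a word depends
      only on the product of the word.
    - The order of [s r] is exactly the label ([order_gen_prod]); this comes
      from the contragredient of the geometric representation, over the
      algebraic numbers, with [z + 1 / z] for a primitive [2m]-th root of unity
      [z] in the role of [2 cos (pi / m)]. *)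

Set Implicit Arguments.
Unset Strict Implicit.
Unset Printing Implicit Defensive.

Import GRing.Theory Num.Theory.

(** * Words in the generators *)

Fixpoint alt (T : Type) (k : nat) (s r : T) : seq T :=
  if k is k'.+1 then s :: alt k' r s else [::].

Lemma size_alt (T : Type) k (s r : T) : size (alt k s r) = k.
Proof. by elim: k s r => //= k IH s r; rewrite IH. Qed.

Lemma map_alt (T U : Type) (f : T -> U) k s r :
  map f (alt k s r) = alt k (f s) (f r).
Proof. by elim: k s r => //= k IH s r; rewrite IH. Qed.

Lemma alt_prefix (T : Type) j k (s r : T) : (j <= k)%N ->
  exists w, alt k s r = alt j s r ++ w.
Proof.
elim: j k s r => [|j IH] [|k] s r //= jk; [by exists [::]|by eexists|].
by have [w ->] := IH k r s jk; exists w.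
Qed.

Lemma all_alt (T : eqType) k (s r : T) : all (pred2 s r) (alt k s r).
Proof.
elim: k s r => //= k IH s r; rewrite eqxx /=.
by rewrite (@eq_all _ _ (pred2 r s)) // => x /=; rewrite orbC.
Qed.

Section Words.
Variables (S : finType) (M : coxeter_matrix S).

Implicit Types (s r t : S) (u v : seq S).

Local Open Scope group_scope.

Local Notation gen := (coxeter_gen M).

Definition word_prod u : coxeter_group M := \prod_(s <- u) gen s.

Definition reduced u : Prop :=
  forall v, word_prod v = word_prod u -> (size u <= size v)%N.

Lemma word_prod_nil : word_prod [::] = 1.
Proof. exact: big_nil. Qed.

Lemma word_prod_cons s u : word_prod (s :: u) = gen s * word_prod u.
Proof. exact: big_cons. Qed.

Lemma word_prod_cat u v : word_prod (u ++ v) = word_prod u * word_prod v.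
Proof. exact: big_cat. Qed.

Lemma gen_sq s : gen s * gen s = 1.
Proof. by rewrite -{2}coxeter_genV mulgV. Qed.

Lemma genK s (x : coxeter_group M) : gen s * (gen s * x) = x.
Proof. by rewrite mulgA gen_sq mul1g. Qed.

Lemma genK_r s (x : coxeter_group M) : x * gen s * gen s = x.
Proof. by rewrite -mulgA gen_sq mulg1. Qed.

Lemma word_prod_class u :
  word_prod u = pres_class (coxeter_relators M) [seq (s, true) | s <- u].
Proof.
elim: u => [|s u IH]; first by rewrite word_prod_nil.
by rewrite word_prod_cons IH /= -cat1s pres_class_cat.
Qed.

Lemma relator_prod s r m : M s r = Some m -> (gen s * gen r) ^+ m = 1.
Proof.
move=> Msr; set w := flatten (nseq m [:: s; r]).
have wE k : word_prod (flatten (nseq k [:: s; r])) = (gen s * gen r) ^+ k.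
  elim: k => [|k IH]; first exact: word_prod_nil.
  by rewrite /= !word_prod_cons IH expgS mulgA.
rewrite -wE word_prod_class; apply: pres_class_relator.
exists s, r, m; split=> //; by elim: (m) => //= k ->.
Qed.

(** The relator [(s r)^m] is the quotient of the two sides of the braid
    relation, because the generators are involutions. *)
Lemma alt_prod k s r :
  word_prod (alt k s r) * (word_prod (alt k r s))^-1 = (gen s * gen r) ^+ k.
Proof.
have swap a b j : gen a * (gen b * gen a) ^+ j = (gen a * gen b) ^+ j * gen a.
  elim: j => [|j IH]; first by rewrite mulg1 mul1g.
  by rewrite !expgS -!mulgA IH.
elim: k s r => [|k IH] s r; first by rewrite !word_prod_nil mulgV.
by rewrite /= !word_prod_cons invgM coxeter_genV mulgA -(mulgA (gen s)) IH swap
           expgSr mulgA.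
Qed.

Lemma braid_prod s r m :
  M s r = Some m -> word_prod (alt m s r) = word_prod (alt m r s).
Proof.
move=> Msr; have := alt_prod m s r; rewrite (relator_prod Msr) => E.
by apply: (mulIg (word_prod (alt m r s))^-1); rewrite E mulgV.
Qed.

(** The universal property of the presentation, for actions on a set. *)
Lemma foldl_word_prod (X : Type) (f : S -> X -> X) :
    (forall s, involutive (f s)) ->
    (forall s r m, s != r -> M s r = Some m ->
       forall x, iter m (fun x => f r (f s x)) x = x) ->
  forall u v, word_prod u = word_prod v ->
  forall x, foldl (fun x s => f s x) x u = foldl (fun x s => f s x) x v.
Proof.
move=> fK frel; pose act x (w : seq (S * bool)) := foldl (fun x a => f a.1 x) x w.
have actE x u : foldl (fun x s => f s x) x u = act x [seq (s, true) | s <- u].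
  by elim: u x => //= s u IH x.
have act_cat x (v w : seq (S * bool)) : act x (v ++ w) = act (act x v) w.
  by rewrite /act foldl_cat.
move=> u v; rewrite !word_prod_class => /pres_classP uv x; rewrite !actE.
elim: uv x => {u v} [u|u v _ IH|u v w _ IH1 _ IH2|u v s b|u v w rel_w] x //.
- by rewrite IH1.
- by rewrite !act_cat /= fK.
- move: rel_w => [s [r [m [Msr ->]]]]; rewrite !act_cat; congr act.
  move: (act x u) => {}x.
  have -> : act x (flatten (nseq m [:: (s, true); (r, true)]))
            = iter m (fun x => f r (f s x)) x.
    elim: m x {Msr} => //= m IH x; rewrite IH; exact: esym (iterSr m _ x).
  have [sr|] := eqVneq s r; last by move=> sr; apply: frel.
  by move: Msr; rewrite sr label_diag => -[<-] /=; rewrite fK.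
Qed.

(** * The exchange condition *)

(** Parity of the number of occurrences of [g] among the reflections
    [s1 ... si ... s1] attached to the word [s1 ... sn]. *)
Fixpoint reflection_parity u (g : coxeter_group M) : bool :=
  if u is s :: u' then
    (g == gen s) (+) reflection_parity u' (gen s * g * gen s)
  else false.

Definition flip s (p : coxeter_group M * bool) : coxeter_group M * bool :=
  (gen s * p.1 * gen s, p.2 (+) (p.1 == gen s)).

Lemma flipK s : involutive (flip s).
Proof.
move=> [g e]; rewrite /flip /=; congr pair.
  by rewrite !mulgA gen_sq mul1g genK_r.
rewrite -addbA; have -> : (gen s * g * gen s == gen s) = (g == gen s).
  apply/eqP/eqP => [E|->]; last by rewrite genK_r.
  apply: (mulgI (gen s)); rewrite gen_sq; apply: (mulIg (gen s)).
  by rewrite E mul1g.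
by rewrite addbb addbF.
Qed.

(** With [c = s r], the reflections of the word [(s r)^m] are the [c^i s] for
    [i < 2m]; as [c^m = 1], each of them occurs an even number of times. *)
Lemma flip_relator s r m : M s r = Some m ->
  forall p, iter m (fun p => flip r (flip s p)) p = p.
Proof.
move=> Msr [g e]; set c := gen s * gen r.
have cV : c^-1 = gen r * gen s by rewrite invgM !coxeter_genV.
have sc k : gen s * c ^- k = c ^+ k * gen s.
  rewrite -expVgn; elim: k => [|k IH]; first by rewrite mulg1 mul1g.
  by rewrite !expgS -(mulgA c) -IH cV /c !mulgA.
have conjE (a x h : coxeter_group M) :
    (a^-1 * h * a == x) = (h == a * x * a^-1).
  by apply/eqP/eqP => [<-|->]; rewrite !mulgA ?mulgV ?mulVg mul1g -mulgA
                                       ?mulgV ?mulVg mulg1.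
have step k : iter k (fun p => flip r (flip s p)) (g, e)
   = (c ^- k * g * c ^+ k, e (+) odd (\sum_(i < k.*2) (g == c ^+ i * gen s)%g)).
  elim: k => [|k IH]; first by rewrite big_ord0 invg1 mul1g mulg1 addbF.
  rewrite iterS IH doubleS !big_ord_recr /flip /=; congr pair.
    by rewrite expgSr invgM cV !mulgA.
  rewrite !oddD !oddb -!addbA; congr (_ (+) (_ (+) (_ (+) _))).
    by rewrite conjE -mulgA sc mulgA -expgnDr addnn.
  rewrite -{1}(coxeter_genV M s) conjE conjE coxeter_genV -/c -!mulgA.
  by rewrite sc !mulgA -(mulgA (c ^+ k)) -expgSr -expgnDr addSn addnn.
rewrite step relator_prod // invg1 mul1g mulg1 -addnn big_split_ord /= oddD.
have -> : \sum_(i < m) (g == c ^+ (m + i)%N * gen s)%g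
        = \sum_(i < m) (g == c ^+ i * gen s)%g.
  by apply: eq_bigr => i _; rewrite expgnDr relator_prod // mul1g.
by rewrite addbb addbF.
Qed.

Lemma reflection_parity_prod u v g : word_prod u = word_prod v ->
  reflection_parity u g = reflection_parity v g.
Proof.
have foldE w p : (foldl (fun p s => flip s p) p w).2
               = p.2 (+) reflection_parity w p.1.
  elim: w p => [|s w IH] [h e] /=; first by rewrite addbF.
  by rewrite IH /= addbA.
move=> uv; have := foldE u (g, false); rewrite /= => <-.
rewrite (foldl_word_prod flipK _ uv); first by rewrite foldE.
by move=> s r m _; apply: flip_relator.
Qed.

(** If [g] is the [i]-th reflection of the word, multiplying by [g] on the left
    cancels the [i]-th letter. *)
Lemma delete_letter u g : reflection_parity u g ->
  exists x t y, u = x ++ t :: y /\ g * word_prod u = word_prod (x ++ y).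
Proof.
elim: u g => //= s u IH g; have [->|_ /IH] := eqVneq g (gen s).
  by exists [::], s, u; rewrite word_prod_cons genK.
move=> [x [t [y [-> E]]]]; exists (s :: x), t, y; split=> //.
by rewrite !cat_cons !word_prod_cons -E !mulgA gen_sq mul1g.
Qed.

(** Let [v] be a word for [s u] that is no longer than [u].  The parities of [s]
    in the reflections of [u] and of [v] differ, so one of the two words loses a
    letter when multiplied by [s].  It is not [v], since [s v] represents the
    same element as the reduced word [u]. *)
Lemma exchange s u : reduced u -> ~ reduced (s :: u) ->
  exists x t y, u = x ++ t :: y /\ gen s * word_prod u = word_prod (x ++ y).
Proof.
move=> ru nr; apply: delete_letter; apply: contrapT => /negP nu.
apply: nr => v vE; rewrite leqNgt; apply/negP => lt_v.
have Eu : word_prod u = word_prod (s :: v).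
  by rewrite word_prod_cons vE word_prod_cons genK.
have /delete_letter[x [t [y [vxy E]]]] : reflection_parity v (gen s).
  move: nu; rewrite (reflection_parity_prod _ Eu) /= eqxx negbK.
  by rewrite gen_sq mul1g.
have := ru (x ++ y); rewrite -E -word_prod_cons => /(_ (esym Eu)).
move: lt_v; rewrite vxy /= !size_cat /= addnS !ltnS => h1 h2.
by have := leq_trans h1 h2; rewrite ltnn.
Qed.

Lemma reduced_catr u v : reduced (u ++ v) -> reduced v.
Proof.
move=> ruv w E; have := ruv (u ++ w).
by rewrite !word_prod_cat E !size_cat leq_add2l; apply.
Qed.

Lemma reduced_catl u v : reduced (u ++ v) -> reduced u.
Proof.
move=> ruv w E; have := ruv (w ++ v).
by rewrite !word_prod_cat E !size_cat leq_add2r; apply.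
Qed.

Lemma reduced_eq u v :
  reduced u -> word_prod v = word_prod u -> size v = size u -> reduced v.
Proof. by move=> ru E sz w; rewrite sz E; apply: ru. Qed.

Lemma reduced_size u v :
  reduced u -> reduced v -> word_prod u = word_prod v -> size u = size v.
Proof. by move=> ru rv E; apply/eqP; rewrite eqn_leq ru // rv. Qed.

Lemma reduced_square s u : ~ reduced [:: s, s & u].
Proof.
move=> /(_ u); rewrite !word_prod_cons genK => /(_ erefl) /=.
by rewrite ltnNge leqnSn.
Qed.

Lemma label_gt0 s r m : M s r = Some m -> (0 < m)%N.
Proof.
have [<-|sr] := eqVneq s r; first by rewrite label_diag => -[<-].
by move/(label_offdiag sr)/ltnW.
Qed.

(** The braid relation turns the last [m] letters of [alt m.+1 s r] into a word
    starting with [s], which cancels the first letter. *)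
Lemma reduced_alt_le s r m k :
  M s r = Some m -> reduced (alt k s r) -> (k <= m)%N.
Proof.
move=> Msr; case: leqP => // /(alt_prefix s r)[w ->] /reduced_catl /=.
move=> /(_ (alt m.-1 r s)); rewrite word_prod_cons -(braid_prod Msr).
case: m Msr => [|m] /label_gt0 // _.
by rewrite /= word_prod_cons genK !size_alt => /(_ erefl); rewrite ltnNge leqnSn.
Qed.

Lemma reduced_two_letters s r u :
  s != r -> all (pred2 s r) u -> reduced (r :: u) ->
  r :: u = alt (size u).+1 r s.
Proof.
elim: u s r => //= t u IH s r sr /andP[/orP[]/eqP-> a] ru.
  congr cons; apply: IH; first by rewrite eq_sym.
    by rewrite (@eq_all _ _ (pred2 s r)) // => x /=; rewrite orbC.
  exact: (@reduced_catr [:: r]).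
by case: (reduced_square ru).
Qed.

(** * Orders of products of two generators *)

(** A primitive [2m]-th root of unity when [m > 0]; the successor of the
    predecessor makes the order positive for all [m]. *)
Definition root_of_unity (m : nat) : algC :=
  sval (C_prim_root_exists (ltn0Sn (m.*2).-1)).

Local Open Scope ring_scope.

(** A Galois conjugate of [2 cos (pi / m)], with the usual conventions that
    the angle is [0] when the label is infinite and [pi] on the diagonal. *)
Definition cosine s t : algC :=
  if s == t then -2 else
  if M s t is Some m then root_of_unity m + (root_of_unity m)^-1 else 2.

(** The dual of the geometric representation, on functions of the simple roots.
    A reflection only reads the value at [s], so that orbits can be computed
    without decomposing the space. *)
Definition rho s (f : {ffun S -> algC}) : {ffun S -> algC} :=
  [ffun t => f t + cosine s t * f s].

Lemma cosine_diag s : cosine s s = -2.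
Proof. by rewrite /cosine eqxx. Qed.

Lemma cosine_sym s r : cosine s r = cosine r s.
Proof. by rewrite /cosine eq_sym label_sym. Qed.

Lemma rhoK s : involutive (rho s).
Proof. by move=> f; apply/ffunP => t; rewrite !ffunE cosine_diag; ring. Qed.

(** Along the iterated application of [rho s], [rho r], [rho s], ... the values
    that are read form one sequence [p] with a linear recurrence of order 2,
    and every coordinate accumulates multiples of them. *)
Lemma iter_rho s r (p : nat -> algC) (f : {ffun S -> algC}) :
    p 0%N = f s -> p 1%N = f r + cosine s r * f s ->
    (forall k, p k.+2 = cosine s r * p k.+1 - p k) ->
  forall k, let h := iter k (fun f => rho r (rho s f)) f in
  h s = p k.*2 /\
  forall t, h t = f t + cosine s t * (\sum_(i < k) p i.*2)
                      + cosine r t * (\sum_(i < k) p i.*2.+1).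
Proof.
move=> p0 p1 pS; set h := fun k => iter k (fun f => rho r (rho s f)) f.
have hS k t : h k.+1 t = h k t + cosine s t * h k s
              + cosine r t * (h k r + cosine s r * h k s) by rewrite !ffunE.
have hp k : h k s = p k.*2 /\ h k r + cosine s r * h k s = p k.*2.+1.
  elim: k => [|k [IHs IHr]]; first by rewrite p0 p1.
  have E : h k.+1 s = p k.+1.*2.
    by rewrite hS IHr IHs cosine_diag (cosine_sym r s) doubleS pS; ring.
  by split=> //; rewrite E hS IHr cosine_diag doubleS [RHS]pS; ring.
move=> k; split; first by case: (hp k).
move=> t; rewrite -/(h k); elim: k => [|k IH].
  by rewrite !big_ord0 !mulr0 !addr0.
by have [IHs IHr] := hp k; rewrite hS IHr IHs IH !big_ord_recr /=; ring.
Qed.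

Lemma root_of_unityP s r m : s != r -> M s r = Some m ->
  exists z : algC, [/\ z != 0, cosine s r = z + z^-1, z ^+ m.*2 = 1
                    & forall k, z ^+ k.*2 = 1 -> (m %| k)%N].
Proof.
move=> sr Msr; exists (root_of_unity m).
rewrite /cosine (negPf sr) Msr /root_of_unity.
have m_gt0 := label_gt0 Msr; case: C_prim_root_exists => z /=.
rewrite prednK ?double_gt0 // => z_prim; split=> //.
- apply/eqP => z0; have /eqP := prim_expr_order z_prim.
  by rewrite z0 expr0n double_eq0 eqn0Ngt m_gt0 eq_sym oner_eq0.
- exact: prim_expr_order.
- by move=> k /eqP; rewrite -(prim_order_dvd z_prim) -!muln2 dvdn_pmul2r.
Qed.

Lemma sum_even_powers (z : algC) m :
  z ^+ 2 != 1 -> z ^+ m.*2 = 1 -> \sum_(i < m) z ^+ i.*2 = 0.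
Proof.
move=> z2 zm; have := subrX1 (z ^+ 2) m.
rewrite -exprM mul2n zm subrr => /esym/eqP; rewrite mulf_eq0 subr_eq0 (negPf z2).
by move=> /eqP E; rewrite -[RHS]E; apply: eq_bigr => i _; rewrite -exprM mul2n.
Qed.

(** The recurrence has the solutions [z^k] and [z^-k].  The sequence is a
    combination of both, so its sums along the even and along the odd indices
    vanish over a full period. *)
Lemma rho_relator s r m : s != r -> M s r = Some m ->
  forall f, iter m (fun f => rho r (rho s f)) f = f.
Proof.
move=> sr Msr f; have [z [z0 az zm z_order]] := root_of_unityP sr Msr.
have zV : z * z^-1 = 1 by rewrite mulfV.
have z2 : z ^+ 2 != 1.
  apply/eqP => z2; have := z_order 1 z2; rewrite dvdn1 => /eqP m1.
  by have := label_offdiag sr Msr; rewrite m1.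
pose A := (f r + cosine s r * f s - f s * z^-1) / (z - z^-1).
pose B := (f s * z - (f r + cosine s r * f s)) / (z - z^-1).
pose p k := A * z ^+ k + B * z^-1 ^+ k.
have [||j|_ E] := @iter_rho s r p f _ _ _ m.
- by rewrite /p !expr0 /A /B; field; rewrite z0 subr_eq0 -expr2.
- by rewrite /p !expr1 /A /B; field; rewrite z0 subr_eq0 -expr2.
- by rewrite /p az !exprS; ring: zV.
apply/ffunP => t; rewrite E.
have sum0 : \sum_(i < m) p i.*2 = 0.
  rewrite big_split -!mulr_sumr /= !sum_even_powers ?mulr0 ?addr0 //.
    by rewrite exprVn invr_eq1.
  by rewrite exprVn zm invr1.
have sum1 : \sum_(i < m) p i.*2.+1 = 0.
  transitivity (A * z * (\sum_(i < m) z ^+ i.*2)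
                + B * z^-1 * (\sum_(i < m) z^-1 ^+ i.*2)).
    rewrite !mulr_sumr -big_split; apply: eq_bigr => i _.
    by rewrite /p !exprS !mulrA.
  rewrite !sum_even_powers ?mulr0 ?addr0 //.
    by rewrite exprVn invr_eq1.
  by rewrite exprVn zm invr1.
by rewrite sum0 sum1 !mulr0 !addr0.
Qed.

(** The initial values can be chosen such that the sequence of [iter_rho] is
    [z^k] for a finite label and [k + 1] for an infinite one.  The first returns
    to its initial value at the index [2k] only if [m] divides [k], the second
    only if [k = 0]. *)
Lemma order_gen_prod s r k : s != r ->
  ((gen s * gen r) ^+ k = 1)%g ->
  (0 < k)%N -> exists2 m, M s r = Some m & (m %| k)%N.
Proof.
move=> sr srk k_gt0.
have rs : r == s = false by rewrite eq_sym (negPf sr).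
have iter1 f : iter k (fun f => rho r (rho s f)) f = f.
  pose w j := flatten (nseq j [:: s; r]).
  have wE : word_prod (w k) = word_prod [::].
    rewrite word_prod_nil -srk; elim: (k) => [|j IH]; first exact: word_prod_nil.
    by rewrite /= !word_prod_cons IH expgS mulgA.
  rewrite -[RHS](foldl_word_prod rhoK rho_relator wE f).
  elim: (k) f => //= j IH f; rewrite -IH; exact: (iterSr j _ f).
case Msr : (M s r) => [m|].
  have [z [z0 az zm z_order]] := root_of_unityP sr Msr.
  have zV : z * z^-1 = 1 by rewrite mulfV.
  exists m => //; apply: z_order.
  (* the value at r such that f r + cosine s r * f s = z *)
  pose f := [ffun t => if t == s then 1 else - z^-1] : {ffun S -> algC}.
  have [||j|] := @iter_rho s r (fun j => z ^+ j) f _ _ _ k.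
  - by rewrite /f ffunE eqxx.
  - by rewrite /f !ffunE eqxx rs az; ring.
  - by rewrite az !exprS; ring: zV.
  by rewrite iter1 ffunE eqxx.
have a2 : cosine s r = 2 by rewrite /cosine (negPf sr) Msr.
pose f := [ffun t => if t == s then 1 else 0] : {ffun S -> algC}.
have [||j|] := @iter_rho s r (fun j => j.+1%:R) f _ _ _ k.
- by rewrite /f ffunE eqxx.
- by rewrite /f !ffunE eqxx rs a2; ring.
- by rewrite a2; ring.
rewrite iter1 ffunE eqxx => /eqP; rewrite (eqr_nat _ 1) => /eqP[] /esym/eqP.
by rewrite double_eq0 eqn0Ngt k_gt0.
Qed.

Local Close Scope ring_scope.

(** * Words related by braid moves *)

Inductive braid_eq : seq S -> seq S -> Prop :=
| BraidRefl u : braid_eq u u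
| BraidTrans u v w : braid_eq u v -> braid_eq v w -> braid_eq u w
| BraidMove x y s r m : M s r = Some m ->
    braid_eq (x ++ alt m s r ++ y) (x ++ alt m r s ++ y).

Lemma braid_eq_cons s u v : braid_eq u v -> braid_eq (s :: u) (s :: v).
Proof.
elim=> {u v} [u|u v w _ uv _ vw|x y t r m Mtr]; first exact: BraidRefl.
  exact: BraidTrans uv vw.
exact: (BraidMove (s :: x)).
Qed.

Lemma braid_eq_size u v : braid_eq u v -> size u = size v.
Proof.
elim=> {u v} [//|u v w _ -> _ ->//|x y s r m _].
by rewrite !size_cat !size_alt.
Qed.

(** Starting from [r v], letters of [v] are traded by the exchange condition for
    [s], [r], [s], ... in front of the word, until the traded letter belongs to
    the alternating prefix; then the prefix is one side of a relation. *)
Lemma dihedral_prefix s r u v : s != r ->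
    reduced (s :: u) -> reduced (r :: v) ->
    word_prod (s :: u) = word_prod (r :: v) ->
  exists m y, [/\ M s r = Some m, word_prod (s :: u) = word_prod (alt m s r ++ y)
                & size (s :: u) = (m + size y)%N].
Proof.
move=> sr ru rv uv; have suv := reduced_size ru rv uv.
suff step y : forall k s' r', (s' == s) && (r' == r) || (s' == r) && (r' == s) ->
    (0 < k)%N -> word_prod (s :: u) = word_prod (alt k s' r' ++ y) ->
    size (s :: u) = (k + size y)%N ->
  exists m y, [/\ M s r = Some m, word_prod (s :: u) = word_prod (alt m s r ++ y)
                & size (s :: u) = (m + size y)%N].
  by apply: (step v 1%N r s); rewrite ?eqxx ?orbT.
have [n] := ubnP (size y); elim: n y => // n IH y lt_y k s' r' sr' k0 E sz.
have ra : reduced (alt k s' r' ++ y).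
  by apply: (reduced_eq ru); rewrite ?E // size_cat size_alt sz.
have nr : ~ reduced (r' :: alt k s' r' ++ y).
  have [w [Ew sw]] : exists w, word_prod (r' :: w) = word_prod (s :: u)
                          /\ size w = size u.
    case/orP: sr' => /andP[_ /eqP->]; last by exists u.
    by exists v; case: suv.
  move=> /(_ w); rewrite word_prod_cons -E -Ew word_prod_cons genK.
  move=> /(_ erefl) /=; rewrite size_cat size_alt -sz sw /=.
  by rewrite ltnNge leqnSn.
have [x [t [z [xz Ez]]]] := exchange ra nr.
have s'r' : s' != r' by case/orP: sr' => /andP[/eqP-> /eqP->] //; rewrite eq_sym.
(* if the traded letter lies in y, the alternating prefix grows by r' *)
have [kx|xk] := leqP k (size x).
  have xE : x = alt k s' r' ++ drop k x.
    have := congr1 (take k) xz; rewrite take_size_cat ?size_alt //.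
    by rewrite takel_cat // => ->; rewrite cat_take_drop.
  have yE : y = drop k x ++ t :: z.
    by move: xz; rewrite {1}xE -catA => /eqP; rewrite eqseq_cat ?eqxx // => /eqP.
  apply: (IH (drop k x ++ z) _ k.+1 r' s') => //.
  - by rewrite -ltnS (leq_trans _ lt_y) // yE !size_cat /= addnS.
  - by rewrite orbC andbC [X in _ || X]andbC.
  - by rewrite E /= word_prod_cons catA -xE -Ez genK.
  - by rewrite sz yE !size_cat /= !addnS.
have [z1 [altE zE]] : exists z1, alt k s' r' = x ++ t :: z1 /\ z = z1 ++ y.
  exists (take (k - size x).-1 z).
  have kE : (k - size x)%N = (k - size x).-1.+1 by rewrite prednK // subn_gt0.
  have := congr1 (take k) xz; have := congr1 (drop k) xz.
  rewrite drop_size_cat ?size_alt // take_size_cat ?size_alt // => yE ->.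
  rewrite take_cat drop_cat ltnNge (ltnW xk) /= kE /= in yE *.
  by rewrite yE cat_take_drop.
have Ealt : word_prod (r' :: x ++ z1) = word_prod (alt k s' r').
  apply: (mulgI (gen r')); apply: (mulIg (word_prod y)).
  by rewrite word_prod_cons genK -mulgA -!word_prod_cat Ez zE catA.
have size_k : (size (x ++ z1)).+1 = k.
  by rewrite -[RHS](size_alt k s' r') altE !size_cat addnS.
have ralt := reduced_catl ra.
have a2 : all (pred2 s' r') (x ++ z1).
  by have := all_alt k s' r'; rewrite altE !all_cat /= => /and3P[-> _ ->].
have rx : reduced (r' :: x ++ z1).
  by apply: (reduced_eq ralt Ealt); rewrite size_alt.
(* prefixing r' to the prefix without the traded letter gives a reduced word in
   s' and r', and such a word alternates *)
have ak : word_prod (alt k s' r') = word_prod (alt k r' s').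
  by rewrite -Ealt (reduced_two_letters s'r' a2 rx) size_k.
have srk : (gen s' * gen r') ^+ k = 1 by rewrite -alt_prod ak mulgV.
have [m Msr mk] := order_gen_prod s'r' srk k0.
have {mk} mE : m = k.
  by apply/eqP; rewrite eqn_leq dvdn_leq // (reduced_alt_le Msr).
subst m; case/orP: sr' Msr E => /andP[/eqP-> /eqP->] Msr E.
  by exists k, y.
exists k, y; split=> //; first by rewrite label_sym.
by rewrite E !word_prod_cat (braid_prod Msr).
Qed.

(** Matsumoto's theorem: when the two words start with different letters, both
    are compared with words which extend the two sides of a relation. *)
Theorem reduced_braid_eq u v : reduced u -> reduced v ->
  word_prod u = word_prod v -> braid_eq u v.
Proof.
have [n] := ubnP (size u); elim: n u v => // n IH u v lt_u ru rv uv.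
have suv := reduced_size ru rv uv.
case: u v lt_u ru rv uv suv => [|s u] [|r v] //= lt_u ru rv uv suv.
  by move=> *; apply: BraidRefl.
have same_head t w w' : reduced (t :: w) -> reduced (t :: w') ->
    word_prod (t :: w) = word_prod (t :: w') -> size w = size u ->
    braid_eq (t :: w) (t :: w').
  move=> rw rw' E sw; apply/braid_eq_cons/IH; rewrite ?sw //.
  - exact: (@reduced_catr [:: t]).
  - exact: (@reduced_catr [:: t]).
  - by apply: (mulgI (gen t)); rewrite -!word_prod_cons.
have [sr|sr] := eqVneq s r.
  by subst r; apply: same_head.
have [m [y [Msr E sz]]] := dihedral_prefix sr ru rv uv.
have m_gt0 := label_gt0 Msr.
have E' : word_prod (alt m r s ++ y) = word_prod (r :: v).
  by rewrite -uv E !word_prod_cat (braid_prod Msr).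
have ra : reduced (alt m s r ++ y).
  by apply: (reduced_eq ru) => //; rewrite size_cat size_alt.
have ra' : reduced (alt m r s ++ y).
  by apply: (reduced_eq rv) => //; rewrite size_cat size_alt -sz /= suv.
apply: (@BraidTrans _ (alt m s r ++ y)).
  by case: (m) m_gt0 ra E => //= k _ ra E; apply: same_head.
apply: (@BraidTrans _ (alt m r s ++ y)); first exact: (@BraidMove [::]).
case: (m) m_gt0 ra' E' sz => //= k _ ra' E' sz; apply: same_head => //.
by apply/eqP; rewrite -eqSS sz size_cat size_alt.
Qed.

Lemma reduced_word_exists (w : coxeter_group M) :
  exists u, [/\ reduced u, word_prod u = w & size u = coxeter_length w].
Proof.
rewrite /coxeter_length; case: ex_minnP => n /asboolP[u wE] n_min.
exists u; rewrite size_tuple; split=> // v vE.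
rewrite size_tuple; apply: n_min; apply/asboolP; exists (in_tuple v).
by rewrite wE; apply/esym.
Qed.

Lemma reduced_length u : reduced u -> coxeter_length (word_prod u) = size u.
Proof.
have [v [rv E <-]] := reduced_word_exists (word_prod u) => ru.
exact: reduced_size.
Qed.

End Words.

(** * Comparison of two Coxeter systems *)

Section Comparison.
Variables (S S' : finType) (M : coxeter_matrix S) (M' : coxeter_matrix S').
Variable phi : S -> S'.
Hypothesis phi_inj : injective phi.
Hypothesis phi_le : forall s r, label_le (M s r) (M' (phi s) (phi r)).

Lemma map_eq_alt u m s' r' : map phi u = alt m s' r' -> (1 < m)%N ->
  exists s r, [/\ u = alt m s r, s' = phi s & r' = phi r].
Proof.
case: m => [|[|m]] //; case: u => [|s [|r u]] //= [<- <- E] _.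
exists s, r; split=> //; apply: (inj_map phi_inj).
by rewrite /= E map_alt.
Qed.

(** A braid move on the image of a reduced word comes from a braid move on the
    word itself: were the label in the second system larger, the word would
    contain an alternating subword that is too long to be reduced. *)
Lemma braid_eq_map u v' : reduced M u -> braid_eq M' (map phi u) v' ->
  exists2 v, v' = map phi v & word_prod M v = word_prod M u.
Proof.
move=> ru uv'; move uE: (map phi u) uv' => u' uv'.
elim: uv' u uE ru => {u' v'} [u'|u' v' w' uv' IH1 _ IH2|x' y' s' r' m Msr] u uE ru.
- by exists u.
- have [v vE Ev] := IH1 u uE ru.
  have rv : reduced M v.
    apply: (reduced_eq ru Ev).
    by rewrite -(size_map phi) -vE -(braid_eq_size uv') -uE size_map.
  by have [w -> Ew] := IH2 v (esym vE) rv; exists w; rewrite // Ew.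
have [x [z [y [uxzy xE zE yE]]]] : exists x z y,
    [/\ u = x ++ z ++ y, map phi x = x', map phi z = alt m s' r' & map phi y = y'].
  exists (take (size x') u), (take m (drop (size x') u)),
         (drop m (drop (size x') u)).
  rewrite !cat_take_drop !map_take !map_drop uE take_size_cat // drop_size_cat //.
  by rewrite take_size_cat ?size_alt // drop_size_cat ?size_alt.
(* a move with label 1 exchanges a letter with itself, and its word does not
   contain the second letter r' *)
have [m1|m_gt1] := leqP m 1%N.
  have {}m1 : m = 1%N by apply/eqP; rewrite eqn_leq m1 (label_gt0 Msr).
  subst m; exists u => //; rewrite uE /=.
  have [-> //|sr] := eqVneq s' r'.
  by have := label_offdiag sr Msr.
have [s [r [zsr sE rE]]] := map_eq_alt zE m_gt1; subst s' r' z.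
have := phi_le s r; rewrite Msr; case Msr0 : (M s r) => [m0|//] /= m0m.
have {}m0m : m0 = m.
  apply/eqP; rewrite eqn_leq m0m (reduced_alt_le Msr0) //.
  by apply: (@reduced_catl _ _ _ y); apply: (@reduced_catr _ _ x); rewrite -uxzy.
subst m0; exists (x ++ alt m r s ++ y); first by rewrite !map_cat xE yE map_alt.
by rewrite uxzy !word_prod_cat (braid_prod Msr0).
Qed.

(** If [phi s] could be exchanged in front of the image of the reduced word [u],
    Matsumoto's theorem would join that image to a word starting with [phi s] by
    braid moves, and these moves would give a word for the same element as [u]
    that starts with [s]. *)
Lemma reduced_map u : reduced M u -> reduced M' (map phi u).
Proof.
elim: u => [|s u IH] rsu; first by move=> v _.
have ru : reduced M u by apply: (@reduced_catr _ _ [:: s]).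
have {}IH := IH ru; apply: contrapT => nr.
have [x [t [y [uE E]]]] := exchange IH nr.
have Ew : word_prod M' (phi s :: x ++ y) = word_prod M' (map phi u).
  by rewrite word_prod_cons -E genK.
have rw : reduced M' (phi s :: x ++ y).
  by apply: (reduced_eq IH Ew); rewrite uE /= !size_cat /= addnS.
have [v vE Ev] := braid_eq_map ru (reduced_braid_eq IH rw (esym Ew)).
have sv : size v = size u.
  by rewrite -(size_map phi) -vE (reduced_size rw IH Ew) size_map.
case: v vE Ev sv => //= s0 v [/phi_inj <- _] Ev sv.
have := rsu v; rewrite word_prod_cons -Ev word_prod_cons genK => /(_ erefl) /=.
by rewrite -sv ltnNge leqnSn.
Qed.

Lemma word_prod_map_inj u v : reduced M u -> reduced M v ->
  word_prod M' (map phi u) = word_prod M' (map phi v) ->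
  word_prod M u = word_prod M v.
Proof.
move=> ru rv /(reduced_braid_eq (reduced_map ru) (reduced_map rv)).
by move=> /(braid_eq_map ru)[w /(inj_map phi_inj) <-].
Qed.

End Comparison.

Theorem theorem1 (S S' : finType)
    (M : coxeter_matrix S) (M' : coxeter_matrix S') :
  coxeter_le M M' ->
  forall k : nat, coxeter_growth M k <= coxeter_growth M' k.
Proof.
move=> [phi [phi_inj phi_le]] k; rewrite /coxeter_growth.
have [red redP] := choice (@reduced_word_exists S M).
pose f w := word_prod M' (map phi (red w)).
have f_inj : injective f.
  move=> w1 w2; have [r1 E1 _] := redP w1; have [r2 E2 _] := redP w2.
  by move/(word_prod_map_inj phi_inj phi_le r1 r2); rewrite E1 E2.
have f_length w : coxeter_length (f w) = coxeter_length w.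
  have [r _ <-] := redP w.
  by rewrite reduced_length ?size_map //; apply: (reduced_map phi_inj phi_le).
set A := fset_set (@coxeter_sphere S M k).
have <- : #|` (f @` A)%fset| = #|` A| by apply: card_imfset.
apply: fsubset_leq_card.
apply/fsubsetP => _ /imfsetP[w wk ->].
rewrite in_fset_set in wk; last exact: finite_coxeter_sphere.
rewrite in_fset_set; last exact: finite_coxeter_sphere.
by move: wk; rewrite !inE /coxeter_sphere /= f_length.
Qed.
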